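(* Under the standing assumptions below, fix $\gamma\in\mathbb R^I_+$, $x_0\in\mathcal X$, $s_0\in\mathcal S$, and define $f:\tilde{\mathcal A}^\infty(x_0)\to\mathbb R$ by $f(a)=\mathbb E_{s_0}\sum_{t\ge0}\beta^t\big(r(x(s^t),a(s^t),s_t)+\sum_i\gamma^ig^i(x(s^t),a(s^t),s_t)\big)$ and $g:\tilde{\mathcal A}^\infty(x_0)\to\ell^\infty$ (indexed by $(t,h^t,i)$, $h^t=(s_0,\tilde a_0,\dots,s_{t-1},\tilde a_{t-1},s_t)\in\mathcal H^t$) by $$g_{t,h^t,i}(a)=\mathbf 1\{(a(s^0),\dots,a(s^{t-1}))=(\tilde a_0,\dots,\tilde a_{t-1})\}\Big(\mathbb E_{s_t}\sum_{n\ge0}\beta^ng^i(x(s^{t+n}),a(s^{t+n}),s_{t+n})-\bar g^i\Big).$$ Let $d=\inf_{\lambda\in(\ell^\infty)^*_+}\sup_{a\in\tilde{\mathcal A}^\infty(x_0)}\big(f(a)+\langle\lambda,g(a)\rangle\big)$, where $(\ell^\infty)^*_+$ is the set of positive continuous linear functionals on $\ell^\infty$. Then $d=D(\gamma,x_0,s_0)=\inf_{\lambda\in\Lambda}\sup_{a\in\tilde{\mathcal A}^\infty(x_0)}L(a,\lambda;\gamma,x_0,s_0)$.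
   Context: Setup. Let $\mathcal S$ be a finite set and $(s_t)_{t\ge0}$ a Markov chain on $\mathcal S$ with transition probabilities $\pi(s'|s)>0$ for all $s,s'\in\mathcal S$; for $s^t=(s_0,\dots,s_t)\in\mathcal S^{t+1}$ write $\pi^t(s^t|s_0)$ for its probability given $s_0$ and $\mathbb E_{s_t}$ for expectation over future shocks given $s^t$. Let $\mathcal A\subset\mathbb R^n$ be a finite set, $\mathcal X\subseteq\mathbb R^m$ a countable set, $\zeta:\mathcal X\times\mathcal A\times\mathcal S\to\mathcal X$, $p:\mathcal X\times\mathcal A\times\mathcal S\to\mathbb R$, $r,g^1,\dots,g^I$ bounded real functions on $\mathcal X\times\mathcal A\times\mathcal S$, $\bar g^i\in\mathbb R$, $\beta\in(0,1)$. A plan is $a=(a(s^t))_{t,s^t}$, $a(s^t)\in\mathcal A$, inducing $x(s^0)=x_0$, $x(s^{t+1})=\zeta(x(s^t),a(s^t),s_t)$. $\tilde{\mathcal A}(x,s)=\{a\in\mathcal A:p(x,a,s)\ge0\}$; $\tilde{\mathcal A}^\infty(x_0)$ is the set of plans with $a(s^t)\in\tilde{\mathcal A}(x(s^t),s_t)$ for all $t,s^t$. A plan is feasible for $(x_0,s_0)$ if it lies in $\tilde{\mathcal A}^\infty(x_0)$ and $\mathbb E_{s_t}\sum_{n\ge0}\beta^ng^i(x(s^{t+n}),a(s^{t+n}),s_{t+n})\ge\bar g^i$ for all $t,s^t,i$. Standing assumption: for every $(x_0,s_0)$ a feasible plan exists. Pre-action histories $h^t=(s_0,a_0,\dots,s_{t-1},a_{t-1},s_t)\in\mathcal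 H^t=\mathcal S^{t+1}\times\mathcal A^t$; a plan generates $h^t=(s_0,a(s^0),\dots,a(s^{t-1}),s_t)$ along $s^t$. Dual value: $\Lambda$ is the set of $(\lambda^i(h^t))_{t,h^t,i}$, $\lambda^i(h^t)\ge0$, $\sum_t\sum_{h^t}\sum_i\beta^t\lambda^i(h^t)\pi^t(s^t|s_0)<\infty$. $L(a,\lambda;\gamma,x_0,s_0)=\mathbb E_{s_0}\sum_t\beta^t\big[r(x(s^t),a(s^t),s_t)+\sum_i\gamma^ig^i(x(s^t),a(s^t),s_t)+\sum_i\lambda^i(h^t)(\sum_{n\ge0}\beta^ng^i(x(s^{t+n}),a(s^{t+n}),s_{t+n})-\bar g^i)\big]$ (with $h^t$ generated by the plan) and $D(\gamma,x_0,s_0)=\inf_{\lambda\in\Lambda}\sup_{a\in\tilde{\mathcal A}^\infty(x_0)}L$. *)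

(* Defs.v *)
From HB Require Import structures.
From mathcomp Require Import all_boot all_order all_algebra.
From mathcomp Require Import all_classical all_reals.
From mathcomp Require Import all_analysis.
Import numFieldNormedType.Exports.
Set Implicit Arguments. Unset Strict Implicit. Unset Printing Implicit Defensive.
Import Order.TTheory GRing.Theory Num.Theory.
Local Open Scope ring_scope.
Local Open Scope classical_set_scope.

Section Model.
Variables (R : realType) (S : finType) (A : finType) (X : countType) (I : nat).
(* pi s s' = pi(s'|s) *)
Variable pi : S -> S -> R.
Variables (zeta : X -> A -> S -> X) (p : X -> A -> S -> R).
Variables (r : X -> A -> S -> R) (g : 'I_I -> X -> A -> S -> R).
Variables (gbar : 'I_I -> R) (beta : R).

(* A plan assigns an action to every history s^t = (s_0,...,s_t), encoded as
   the sequence [:: s_0; ...; s_t]; its value on the empty sequence is unused. *)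
Definition plan := seq S -> A.

(* x(s^t) generated by the plan from x(s^0) = x0, x(s^{t+1}) = zeta(x(s^t), a(s^t), s_t). *)
Fixpoint xaux (a : plan) (x : X) (pre : seq S) (rest : seq S) : X :=
  match rest with
  | [::] => x
  | s :: rest' =>
      if rest' is [::] then x
      else xaux a (zeta x (a (rcons pre s)) s) (rcons pre s) rest'
  end.
Definition xof (x0 : X) (a : plan) (h : seq S) : X := xaux a x0 [::] h.

Fixpoint pprob (s : S) (v : seq S) : R :=
  match v with [::] => 1 | s' :: v' => pi s s' * pprob s' v' end.

Definition pathprob (s0 : S) (t : nat) (st : (t.+1).-tuple S) : R :=
  if thead st == s0 then pprob s0 (behead st) else 0.

Definition rseries (u : nat -> R) : R := limn (series u).

Definition Atilde (x : X) (s : S) : set A := [set a | 0 <= p x a s].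
Definition Aplans (x0 : X) : set plan :=
  [set a | forall (s : S) (u : seq S), Atilde (xof x0 a (s :: u)) (last s u) (a (s :: u))].

Definition condG (x0 : X) (a : plan) (i : 'I_I) (s : S) (u : seq S) : R :=
  rseries (fun n => beta ^+ n *
    \sum_(v : n.-tuple S) pprob (last s u) v *
       g i (xof x0 a (s :: u ++ v)) (a (s :: u ++ v)) (last s (u ++ v))).

Definition feasible (x0 : X) (s0 : S) (a : plan) : Prop :=
  Aplans x0 a /\ forall (u : seq S) (i : 'I_I), gbar i <= condG x0 a i s0 u.

(* index set of l^infty: (t, h^t, i) with h^t in S^{t+1} x A^t *)
Definition Jfam (t : nat) : Type := ((t.+1).-tuple S * t.-tuple A * 'I_I)%type.
Definition J : Type := {t : nat & Jfam t}.
Definition jmk (t : nat) (st : (t.+1).-tuple S) (ac : t.-tuple A) (i : 'I_I) : J :=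
  existT Jfam t (st, ac, i).

Definition actions_along (a : plan) (t : nat) (st : (t.+1).-tuple S) : t.-tuple A :=
  [tuple a (take k.+1 st) | k < t].

Definition fobj (gamma : 'I_I -> R) (x0 : X) (s0 : S) (a : plan) : R :=
  rseries (fun t => beta ^+ t *
    \sum_(u : t.-tuple S) pprob s0 u *
      (r (xof x0 a (s0 :: u)) (a (s0 :: u)) (last s0 u)
       + \sum_i gamma i * g i (xof x0 a (s0 :: u)) (a (s0 :: u)) (last s0 u))).

Definition gvec (x0 : X) (a : plan) (j : J) : R :=
  match j with
  | existT t (st, ac, i) =>
      (actions_along a st == ac)%:R * (condG x0 a i (thead st) (behead st) - gbar i)
  end.

Definition Lag (gamma : 'I_I -> R) (x0 : X) (s0 : S) (a : plan) (lam : J -> R) : R :=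
  rseries (fun t => beta ^+ t *
    \sum_(u : t.-tuple S) pprob s0 u *
      (r (xof x0 a (s0 :: u)) (a (s0 :: u)) (last s0 u)
       + \sum_i gamma i * g i (xof x0 a (s0 :: u)) (a (s0 :: u)) (last s0 u)
       + \sum_i lam (jmk [tuple of s0 :: u] (actions_along a [tuple of s0 :: u]) i)
                 * (condG x0 a i s0 u - gbar i))).

Definition Lambda (s0 : S) : set (J -> R) :=
  [set lam | (forall j, 0 <= lam j) /\
    (\sum_(t <oo) (beta ^+ t * \sum_(st : (t.+1).-tuple S) \sum_(ac : t.-tuple A)
        \sum_i lam (jmk st ac i) * pathprob s0 st)%:E < +oo)%E].

Definition Dval (gamma : 'I_I -> R) (x0 : X) (s0 : S) : \bar R :=
  ereal_inf [set ereal_sup [set (Lag gamma x0 s0 a lam)%:E | a in Aplans x0]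
            | lam in Lambda s0].

End Model.

(* l^infty(J) and its positive continuous linear functionals.  A functional is
   represented as a map (J -> R) -> R whose values off l^infty are irrelevant. *)
Section Linfty.
Variables (R : realType) (J : Type).

Definition linfty : set (J -> R) := [set x | exists M : R, forall j, `|x j| <= M].

Definition pos_cont_functional (phi : (J -> R) -> R) : Prop :=
  [/\ (forall x y, linfty x -> linfty y -> phi (x \+ y) = phi x + phi y),
      (forall (c : R) x, linfty x -> phi (fun j => c * x j) = c * phi x),
      (exists C : R, forall x (M : R), (forall j, `|x j| <= M) -> `|phi x| <= C * M)
    & (forall x, linfty x -> (forall j, 0 <= x j) -> 0 <= phi x)].

Definition ldual_pos : set ((J -> R) -> R) := [set phi | pos_cont_functional phi].
End Linfty.

(* Main.v *)
(** A functional phi dominates its countably additive part: with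
  w_j = phi(e_j), positivity gives phi(x) >= sum_(j in F) w_j x_j for every
  finite set F of coordinates off which x is nonnegative.  Given a plan a, let
  a^T follow a before date T and switch at T to a feasible continuation plan
  (at date 0 on the branches starting in a state other than s0).  Then g(a^T)
  is nonnegative off the finitely many coordinates with t < T and first state
  s0, and there it differs from g(a) by O(beta^(T-t)).  Hence the values
  f(a^T) + phi(g(a^T)) asymptotically dominate L(a, lambda), where lambda is w
  divided by beta^t pi^t, which gives d >= D.  Conversely every multiplier in
  Lambda defines a positive continuous functional with the same Lagrangian. *)

Require Import Defs.
From HB Require Import structures.
From mathcomp Require Import all_boot all_order all_algebra.
From mathcomp Require Import all_classical all_reals.
From mathcomp Require Import all_analysis.
Import numFieldNormedType.Exports.
Import Order.TTheory GRing.Theory Num.Theory.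
Local Open Scope ring_scope.
Local Open Scope classical_set_scope.
Set Implicit Arguments. Unset Strict Implicit. Unset Printing Implicit Defensive.

(** * Dominated series and discounting *)

Section RealSeries.
Variable R : realType.
Implicit Types u v w : nat -> R.

Lemma eq_rseries u v : u =1 v -> rseries u = rseries v.
Proof. by move=> /funext->. Qed.

Lemma series_dominated u w : (forall n, `|u n| <= w n) -> cvgn (series w) ->
  cvgn (series u).
Proof.
move=> uw cw; apply: normed_cvg; apply: (@series_le_cvg _ _ w) => //= n.
exact: le_trans (normr_ge0 _) (uw n).
Qed.

Lemma ler_norm_rseries u w : (forall n, `|u n| <= w n) -> cvgn (series w) ->
  `|rseries u| <= rseries w.
Proof.
move=> uw cw.
have nu : cvgn [normed series u].
  by apply: (@series_le_cvg _ _ w) => //= n; exact: le_trans (normr_ge0 _) (uw n).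
exact: le_trans (lim_series_norm nu) (lim_series_le nu cw uw).
Qed.

Lemma rseriesD u v : cvgn (series u) -> cvgn (series v) ->
  rseries (fun n => u n + v n) = rseries u + rseries v.
Proof. exact: lim_seriesD. Qed.

Lemma rseriesB u v : cvgn (series u) -> cvgn (series v) ->
  rseries (fun n => u n - v n) = rseries u - rseries v.
Proof. exact: lim_seriesB. Qed.

Lemma rseriesZ (c : R) u : cvgn (series u) ->
  rseries (fun n => c * u n) = c * rseries u.
Proof. exact: lim_seriesZ. Qed.

Lemma rseries_ge0 u : (forall n, 0 <= u n) -> cvgn (series u) -> 0 <= rseries u.
Proof.
move=> u0 cu; apply: limr_ge => //; apply: nearW => n.
by apply: sumr_ge0 => i _.
Qed.

Lemma series_nneg_bounded w (W : R) : (forall n, 0 <= w n) ->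
  (forall N, \sum_(n < N) w n <= W) -> cvgn (series w) /\ rseries w <= W.
Proof.
move=> w0 wW.
have sW N : series w N <= W by rewrite /series/= big_mkord.
have cw : cvgn (series w).
  apply: nondecreasing_is_cvgn; first exact: nondecreasing_series.
  by exists W => _ [N _ <-].
by split => //; apply: limr_le => //; apply: nearW.
Qed.

(** The factor [1 - beta] makes the sum telescope; [maxn k N] covers the case [N <= k], where both
    sides vanish. *)
Lemma geometric_tail_sum (beta : R) k N :
  (\sum_(n < N) (k <= n)%N%:R * beta ^+ n) * (1 - beta)
    = beta ^+ k - beta ^+ maxn k N.
Proof.
elim: N => [|N IH]; first by rewrite big_ord0 maxn0 mul0r subrr.
rewrite big_ord_recr/= mulrDl IH; case: leqP => kN.
  rewrite (maxn_idPr (leqW kN)) mul1r exprSr mulrBr mulr1.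
  by rewrite addrA subrK.
by rewrite (maxn_idPl kN) !mul0r addr0.
Qed.

Lemma geometric_tail (beta : R) k : 0 < beta < 1 ->
  cvgn (series (fun n => (k <= n)%N%:R * beta ^+ n)) /\
  rseries (fun n => (k <= n)%N%:R * beta ^+ n) <= beta ^+ k / (1 - beta).
Proof.
move=> /andP[b0 b1]; apply: series_nneg_bounded => [n|N].
  by rewrite mulr_ge0// exprn_ge0// ltW.
rewrite ler_pdivlMr ?subr_gt0// geometric_tail_sum lerBlDr lerDl.
by rewrite exprn_ge0// ltW.
Qed.

(** Source of the error bounds below: plans that agree before date [k] have discounted terms
    differing only from [k] on. *)
Lemma discounted_tail (beta M : R) u k : 0 < beta < 1 ->
  (forall n, `|u n| <= M * beta ^+ n) -> (forall n, (n < k)%N -> u n = 0) ->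
  cvgn (series u) /\ `|rseries u| <= M * beta ^+ k / (1 - beta).
Proof.
move=> hb uM u0; have [ct lt] := geometric_tail k hb.
have M0 : 0 <= M by move: (uM 0); rewrite expr0 mulr1; apply: le_trans.
have ut n : `|u n| <= M * ((k <= n)%N%:R * beta ^+ n).
  by case: leqP => kn; [rewrite mul1r|rewrite u0// normr0 mul0r mulr0].
have cM : cvgn (series (fun n => M * ((k <= n)%N%:R * beta ^+ n))).
  exact: is_cvg_seriesZ.
split; first exact: series_dominated cM.
apply: (le_trans (ler_norm_rseries ut cM)).
by rewrite rseriesZ// -mulrA ler_wpM2l.
Qed.

(* K_T satisfies K_(T+1) = beta (K_T + w_T), so its partial sums are bounded. *)
Lemma cvg_discounted_convolution (beta : R) w : 0 < beta < 1 ->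
  (forall n, 0 <= w n) -> cvgn (series w) ->
  (fun T => \sum_(t < T) w t * beta ^+ (T - t)) @ \oo --> (0 : R).
Proof.
move=> /andP[b0 b1] w0 cw.
set K := fun T : nat => _.
have K0 T : 0 <= K T.
  by apply: sumr_ge0 => t _; rewrite mulr_ge0// exprn_ge0// ltW.
have KS T : K T.+1 = beta * (K T + w T).
  rewrite /K big_ord_recr/= subSnn expr1 mulrDr mulr_sumr (mulrC (w T)).
  congr (_ + _).
  by apply: eq_bigr => t _; rewrite subSn ?exprS 1?ltnW// mulrCA.
have wW N : \sum_(t < N) w t <= rseries w.
  have := nondecreasing_cvgn_le (nondecreasing_series (fun n _ _ => w0 n)) cw N.
  by rewrite /series/= big_mkord.
(* The limit 0 is read off from summability of [K]. *)
apply: cvg_series_cvg_0.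
apply: (series_nneg_bounded (W := beta * rseries w / (1 - beta)) K0 _).1 => N.
have KW : \sum_(n < N) K n <= beta * (\sum_(n < N) K n + rseries w).
  case: N => [|N]; first by rewrite big_ord0 add0r mulr_ge0 ?(ltW b0)// rseries_ge0.
  rewrite [leLHS]big_ord_recl {1}/K big_ord0 add0r.
  rewrite (eq_bigr (fun i : 'I_N => beta * (K i + w i))) => [|i _]; last exact: KS.
  rewrite -mulr_sumr ler_wpM2l ?(ltW b0)// big_split/= lerD ?wW//.
  by rewrite big_ord_recr/= lerDl.
by rewrite ler_pdivlMr ?subr_gt0// mulrBr mulr1 lerBlDl (mulrC _ beta) -mulrDr.
Qed.

End RealSeries.

(** * Positive functionals on bounded families *)

Section PositiveFunctional.
Variables (R : realType) (J : eqType) (phi : (J -> R) -> R).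
Hypothesis hphi : pos_cont_functional phi.

Definition unit_vec (j : J) : J -> R := fun j' => (j' == j)%:R.

Lemma linfty_unit_vec j : linfty (unit_vec j).
Proof. by exists 1 => j'; rewrite /unit_vec normr_nat lern1 leq_b1. Qed.

Lemma linftyZ (c : R) x : linfty x -> linfty (fun j : J => c * x j).
Proof.
by move=> [M hM]; exists (`|c| * M) => j; rewrite normrM ler_wpM2l.
Qed.

Lemma linftyD (x y : J -> R) : linfty x -> linfty y -> linfty (x \+ y).
Proof.
move=> [M hM] [N hN]; exists (M + N) => j.
exact: le_trans (ler_normD _ _) (lerD _ _).
Qed.

Lemma functional_unit_vec_ge0 j : 0 <= phi (unit_vec j).
Proof.
case: hphi => _ _ _; apply; first exact: linfty_unit_vec.
by move=> j'; rewrite /unit_vec ler0n.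
Qed.

(** Boundedness is carried through the induction because additivity of [phi] is given only on
    [linfty]. *)
Lemma functional_sum_unit_vec (K : Type) (s : seq K) (e : K -> J) (c : K -> R) :
  linfty (fun j => \sum_(k <- s) c k * unit_vec (e k) j) /\
  phi (fun j => \sum_(k <- s) c k * unit_vec (e k) j)
    = \sum_(k <- s) c k * phi (unit_vec (e k)).
Proof.
have [phiD phiZ _ _] := hphi.
elim: s => [|k s [IHl IHe]].
  have -> : (fun j => \sum_(k <- [::]) c k * unit_vec (e k) j) = fun=> 0.
    by apply/funext => j; rewrite big_nil.
  rewrite big_nil; split; first by exists 0 => j; rewrite normr0.
  have l0 : linfty (fun=> 0 : R) by exists 0 => j; rewrite normr0.
  rewrite -[RHS](mul0r (phi (fun=> 0))) -phiZ//.
  by congr phi; apply/funext => j; rewrite mul0r.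
have -> : (fun j => \sum_(k <- k :: s) c k * unit_vec (e k) j) =
    (fun j => c k * unit_vec (e k) j) \+
    (fun j => \sum_(k <- s) c k * unit_vec (e k) j).
  by apply/funext => j; rewrite big_cons.
have lk := linftyZ (c k) (linfty_unit_vec (e k)).
split; first exact: linftyD.
by rewrite phiD// IHe phiZ ?big_cons//; exact: linfty_unit_vec.
Qed.

(** Split [x] into [y], its restriction to the range of [e], and a remainder to which positivity of
    [phi] applies. *)
Lemma functional_ge_partial_sum (K : finType) (e : K -> J) x :
  injective e -> linfty x -> (forall j, (forall k, j != e k) -> 0 <= x j) ->
  \sum_k x (e k) * phi (unit_vec (e k)) <= phi x.
Proof.
move=> ie lx x0; have [phiD phiZ _ phi0] := hphi.
have [ly <-] := functional_sum_unit_vec (index_enum K) e (x \o e).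
set y := fun j => _ in ly *.
have lz : linfty (x \+ (fun j => -1 * y j)) by apply: linftyD => //; exact: linftyZ.
have -> : x = y \+ (x \+ (fun j => -1 * y j)).
  by apply/funext => j /=; rewrite mulN1r addrC subrK.
rewrite [leRHS]phiD// lerDl; apply: phi0 => // j /=; rewrite mulN1r subr_ge0 /y.
(* The remainder is 0 on the range of [e], where injectivity leaves one term of [y], and equals [x]
   off it. *)
have [[k ->]|ne] := pselect (exists k, j = e k).
  rewrite (bigD1 k)//= /unit_vec eqxx mulr1 big1 ?addr0// => k' k'k.
  by rewrite (inj_eq ie) eq_sym (negbTE k'k) mulr0.
rewrite big1 => [|k _]; first by apply: x0 => k; apply/eqP => jk; apply: ne; exists k.
rewrite /unit_vec; case: eqP => [jk|]; last by rewrite mulr0.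
by case: ne; exists k.
Qed.

End PositiveFunctional.

(** * Splicing plans *)

Section Splice.
Variables (R : realType) (S A : finType) (X : countType) (zeta : X -> A -> S -> X).
Implicit Types (a : plan S A) (x : X) (s : S) (h u v : seq S).

Lemma xof1 x a s : xof zeta x a [:: s] = x.
Proof. by []. Qed.

Lemma xof_rcons x a s u s' :
  xof zeta x a (s :: rcons u s')
    = zeta (xof zeta x a (s :: u)) (a (s :: u)) (last s u).
Proof.
(* The induction on [u] needs an arbitrary accumulated prefix. *)
suff H y pre : xaux zeta a y pre (s :: rcons u s')
    = zeta (xaux zeta a y pre (s :: u)) (a (pre ++ s :: u)) (last s u) by exact: H.
elim: u s y pre => [|s1 u IH] s y pre; first by rewrite /= cats1.
rewrite rcons_cons.
have xauxS w : xaux zeta a y pre [:: s, s1 & w] =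
    xaux zeta a (zeta y (a (rcons pre s)) s) (rcons pre s) (s1 :: w) by [].
by rewrite !xauxS IH -cats1 -catA.
Qed.

(* [tau s] is the date at which a history starting in [s] switches from [a] to
   the continuation plan [b x s'] of the state [(x, s')] reached at that date. *)
Definition splice (tau : S -> nat) (b : X -> S -> plan S A) (x0 : X) a :
    plan S A := fun h =>
  if h is s :: _ then
    if drop (tau s) h is s' :: u then
      b (xof zeta x0 a (rcons (take (tau s) h) s')) s' (s' :: u)
    else a h
  else a h.

Variables (tau : S -> nat) (b : X -> S -> plan S A) (x0 : X) (a : plan S A).
Local Notation c := (splice tau b x0 a).

Lemma splice_before s u : (size u < tau s)%N -> c (s :: u) = a (s :: u).
Proof. by move=> ut; rewrite /splice drop_oversize. Qed.

Lemma xof_splice_before s u : (size u <= tau s)%N ->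
  xof zeta x0 c (s :: u) = xof zeta x0 a (s :: u).
Proof.
elim/last_ind: u => [//|u s' IH]; rewrite size_rcons => ut.
by rewrite !xof_rcons IH 1?ltnW// splice_before.
Qed.

(** [head s h] is the first state of [h ++ s :: u], also when [h] is empty and the switch occurs at
    date 0. *)
Lemma splice_after h s u : size h = tau (head s h) ->
  c (h ++ s :: u) = b (xof zeta x0 a (rcons h s)) s (s :: u).
Proof.
case: h => [|s0 h] /= ht; first by rewrite -ht.
rewrite -ht /= drop_size_cat// take_size_cat//.
Qed.

(** From the switch on both sides obey the same recursion: the continuation plan starts at the state
    reached and reads only the history since the switch. *)
Lemma xof_splice_after h s u : size h = tau (head s h) ->
  xof zeta x0 c (h ++ s :: u)
    = xof zeta (xof zeta x0 a (rcons h s)) (b (xof zeta x0 a (rcons h s)) s) (s :: u).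
Proof.
move=> ht; elim/last_ind: u => [|u s' IH].
  case: h ht => [|s0 h] //= ht; rewrite xof1 cats1.
  by rewrite xof_splice_before// size_rcons ht.
rewrite xof_rcons -IH -splice_after//.
case: h ht {IH} => [|s0 h] ht; first by rewrite /= xof_rcons.
by rewrite !cat_cons -rcons_cons -rcons_cat xof_rcons last_cat.
Qed.

Lemma split_history s u : (tau s <= size u)%N ->
  exists h s' u', [/\ s :: u = h ++ s' :: u', size h = tau (head s' h) &
    last s u = last s' u'].
Proof.
move=> su; have sd : (tau s < size (s :: u))%N by [].
exists (take (tau s) (s :: u)), (nth s (s :: u) (tau s)), (drop (tau s).+1 (s :: u)).
have E : s :: u = take (tau s) (s :: u) ++
    nth s (s :: u) (tau s) :: drop (tau s).+1 (s :: u).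
  by rewrite -drop_nth// cat_take_drop.
split => //.
- rewrite size_takel; last exact: ltnW.
  by case e: (tau s) => [|t] /=; rewrite e.
- by rewrite -[LHS]/(last s (s :: u)) {1}E last_cat.
Qed.

End Splice.

(** * Discounted expectations *)

Lemma big_tuple_cons (R : nmodType) (S : finType) n (F : n.+1.-tuple S -> R) :
  \sum_v F v = \sum_s \sum_(u : n.-tuple S) F [tuple of s :: u].
Proof.
rewrite pair_bigA/=.
rewrite (reindex (fun q : S * n.-tuple S => [tuple of q.1 :: q.2]))//.
exists (fun v => (thead v, [tuple of behead v])) => [[s u] _|v _] /=.
  by rewrite theadE; congr (_, _); apply: val_inj.
by rewrite -tuple_eta.
Qed.

Section Model.
Variables (R : realType) (S A : finType) (X : countType) (I : nat).
Variable pi : S -> S -> R.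
Variables (zeta : X -> A -> S -> X) (p : X -> A -> S -> R).
Variables (r : X -> A -> S -> R) (g : 'I_I -> X -> A -> S -> R).
Variables (gbar : 'I_I -> R) (beta : R).
Hypothesis hpi_pos : forall s s', 0 < pi s s'.
Hypothesis hpi_sum : forall s, \sum_(s' : S) pi s s' = 1.
Hypothesis hbeta : 0 < beta < 1.

Let beta_gt0 : 0 < beta. Proof. by case/andP: hbeta. Qed.

Lemma pprob_gt0 s v : 0 < pprob pi s v.
Proof. by elim: v s => [|s' v IH] s /=; rewrite ?ltr01 ?mulr_gt0. Qed.

Lemma pprob_sum s n : \sum_(v : n.-tuple S) pprob pi s v = 1.
Proof.
elim: n s => [|n IH] s.
  rewrite (eq_bigr (fun=> 1)) => [|v _]; last by rewrite tuple0.
  by rewrite sumr_const card_tuple expn0.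
rewrite big_tuple_cons -(hpi_sum s); apply: eq_bigr => s' _ /=.
by rewrite -mulr_sumr IH mulr1.
Qed.

(** Expected discounted sum over the futures of [s]; [condG] and [fobj] are instances by
    conversion. *)
Definition dsum (s : S) (F : seq S -> R) : R :=
  rseries (fun n => beta ^+ n * \sum_(v : n.-tuple S) pprob pi s v * F v).

(** Path probabilities of each length sum to 1, so every undiscounted expectation is bounded by
    [M]. *)
Lemma dsum_tail (M : R) k s (F : seq S -> R) : (forall v, `|F v| <= M) ->
  (forall v, (size v < k)%N -> F v = 0) ->
  cvgn (series (fun n => beta ^+ n * \sum_(v : n.-tuple S) pprob pi s v * F v)) /\
  `|dsum s F| <= M * beta ^+ k / (1 - beta).
Proof.
move=> FM F0; apply: (discounted_tail hbeta) => [n|n nk]; last first.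
  by rewrite big1 ?mulr0// => v _; rewrite F0 ?size_tuple ?mulr0.
rewrite normrM ger0_norm ?exprn_ge0 ?(ltW beta_gt0)// mulrC ler_wpM2r//.
  by rewrite exprn_ge0// ltW.
apply: le_trans (ler_norm_sum _ _ _) _.
rewrite -[leRHS]mul1r -(pprob_sum s n) mulr_suml ler_sum// => v _.
by rewrite normrM ger0_norm ?(ltW (pprob_gt0 _ _))// ler_wpM2l// ltW// pprob_gt0.
Qed.

Lemma cvg_dsum (M : R) s (F : seq S -> R) : (forall v, `|F v| <= M) ->
  cvgn (series (fun n => beta ^+ n * \sum_(v : n.-tuple S) pprob pi s v * F v)).
Proof. by move=> FM; have [] := @dsum_tail M 0 s F FM. Qed.

Lemma norm_dsum (M : R) s (F : seq S -> R) : (forall v, `|F v| <= M) ->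
  `|dsum s F| <= M / (1 - beta).
Proof.
move=> FM; have F0 v : (size v < 0)%N -> F v = 0 by [].
by have [_] := dsum_tail s FM F0; rewrite expr0 mulr1.
Qed.

Lemma dsum_close (M : R) k s (F F' : seq S -> R) :
  (forall v, `|F v| <= M) -> (forall v, `|F' v| <= M) ->
  (forall v, (size v < k)%N -> F v = F' v) ->
  `|dsum s F - dsum s F'| <= (M + M) / (1 - beta) * beta ^+ k.
Proof.
move=> FM FM' FF'; rewrite /dsum -rseriesB; [|exact: cvg_dsum FM|exact: cvg_dsum FM'].
rewrite (eq_rseries (v := fun n =>
    beta ^+ n * \sum_(v : n.-tuple S) pprob pi s v * (F v - F' v))) => [|n]; last first.
  rewrite -mulrBr -sumrB; congr (_ * _).
  by apply: eq_bigr => v _; rewrite -mulrBr.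
rewrite mulrAC; apply: (dsum_tail (F := fun v => F v - F' v) s _ _).2 => v.
  by rewrite (le_trans (ler_normB _ _))// lerD.
by move=> vk; rewrite FF' ?subrr.
Qed.

Variable G : R.
Hypothesis hG : forall i x a s, `|g i x a s| <= G.

Local Notation condG := (condG pi zeta g beta).
Local Notation gvec := (gvec pi zeta g gbar beta).
Local Notation xof := (xof zeta).
Local Notation J := (J S A I).

Lemma condGE x a i s u : condG x a i s u =
  dsum (last s u) (fun v => g i (xof x a (s :: u ++ v)) (a (s :: u ++ v)) (last s (u ++ v))).
Proof. by []. Qed.

(** Summing all [|gbar i|] keeps the bound independent of the coordinate. *)
Lemma norm_gvec x a j :
  `|gvec x a j| <= G / (1 - beta) + \sum_i `|gbar i|.
Proof.
case: j => t [[st ac] i] /=.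
rewrite normrM normr_nat.
rewrite (le_trans (y := 1 * `|condG x a i (thead st) (behead st) - gbar i|))//.
  by rewrite ler_wpM2r// lern1 leq_b1.
rewrite mul1r (le_trans (ler_normB _ _))// lerD//.
  by rewrite condGE; apply: norm_dsum => v.
by rewrite (bigD1 i)//= lerDl sumr_ge0.
Qed.

Lemma linfty_gvec x a : linfty (gvec x a).
Proof. exists (G / (1 - beta) + \sum_i `|gbar i|); exact: norm_gvec. Qed.

(** * Effect of splicing on constraints, admissibility and objective *)

Section Splicing.
Variables (tau : S -> nat) (b : X -> S -> plan S A) (x0 : X) (a : plan S A).
Hypothesis hb : forall x s, feasible pi zeta p g gbar beta x s (b x s).
Local Notation c := (splice zeta tau b x0 a).

(** After [s :: u] the two plans still agree for [tau s - size u] dates; past the switch this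
    truncated difference is 0 and the bound is the crude one. *)
Lemma condG_splice_close i s u :
  `|condG x0 c i s u - condG x0 a i s u|
    <= (G + G) / (1 - beta) * beta ^+ (tau s - size u).
Proof.
rewrite !condGE; apply: dsum_close => // v; rewrite ltn_subRL => uv.
have uvt : (size (u ++ v) < tau s)%N by rewrite size_cat.
by rewrite xof_splice_before ?(ltnW uvt)// splice_before.
Qed.

(** By the Markov property the value equals that of the continuation plan from the state reached,
    whose feasibility covers every later history. *)
Lemma condG_splice_after i s u : (tau s <= size u)%N -> gbar i <= condG x0 c i s u.
Proof.
move=> /split_history[h [s' [u' [E ht El]]]].
have -> : condG x0 c i s u =
    condG (xof x0 a (rcons h s')) (b (xof x0 a (rcons h s')) s') i s' u'.
  rewrite !condGE El; congr dsum; apply/funext => v.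
  rewrite !last_cat El -!cat_cons E -catA cat_cons.
  by rewrite xof_splice_after// splice_after.
exact: (hb _ _).2.
Qed.

Lemma Aplans_splice : Aplans zeta p x0 a -> Aplans zeta p x0 c.
Proof.
move=> ha s u; have [ut|/split_history[h [s' [u' [E ht El]]]]] := ltnP (size u) (tau s).
  by rewrite splice_before// xof_splice_before ?(ltnW ut)//; exact: ha.
rewrite E El xof_splice_after// splice_after//.
exact: (hb _ _).1.
Qed.

(** The coordinate is 0 if [ac] is not generated by the plan, and otherwise the slack of a
    constraint that holds after the switch. *)
Lemma gvec_splice_ge0 t (st : t.+1.-tuple S) ac i :
  (tau (thead st) <= t)%N -> 0 <= gvec x0 c (jmk st ac i).
Proof.
move=> tt; rewrite /= mulr_ge0// subr_ge0 condG_splice_after//.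
by rewrite size_behead size_tuple.
Qed.

Lemma gvec_splice_close t (st : t.+1.-tuple S) ac i :
  (t < tau (thead st))%N ->
  `|gvec x0 c (jmk st ac i) - gvec x0 a (jmk st ac i)|
    <= (G + G) / (1 - beta) * beta ^+ (tau (thead st) - t).
Proof.
move=> tt /=.
(* All actions in the string precede the switch, so the two indicators coincide. *)
have -> : actions_along c st = actions_along a st.
  apply: eq_from_tnth => k; rewrite !tnth_mktuple.
  case/tupleP: st tt => s u; rewrite theadE => tt.
  by rewrite -[take _ _]/(s :: take k u) splice_before// size_takel ?size_tuple
    ?(ltn_trans (ltn_ord k))// ltnW.
rewrite -mulrBr opprB addrA subrK normrM normr_nat.
have := condG_splice_close i (thead st) (behead st).
rewrite size_behead size_tuple /=; apply: le_trans.
by rewrite ler_piMl// lern1 leq_b1.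
Qed.

Lemma fobj_splice_close (gamma : 'I_I -> R) s (M : R) :
  (forall x a s, `|r x a s + \sum_i gamma i * g i x a s| <= M) ->
  `|fobj pi zeta r g beta gamma x0 s a - fobj pi zeta r g beta gamma x0 s c|
    <= (M + M) / (1 - beta) * beta ^+ (tau s).
Proof.
move=> hM; apply: (dsum_close s (F := fun u => r (xof x0 a (s :: u)) (a (s :: u)) (last s u)
  + \sum_i gamma i * g i (xof x0 a (s :: u)) (a (s :: u)) (last s u))
  (F' := fun u => r (xof x0 c (s :: u)) (c (s :: u)) (last s u)
  + \sum_i gamma i * g i (xof x0 c (s :: u)) (c (s :: u)) (last s u))) => // u ut.
by rewrite xof_splice_before ?(ltnW ut)// splice_before.
Qed.

End Splicing.
End Model.

(** * Multipliers and functionals *)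

Lemma sum_triple (R : nmodType) (B C D : finType) (F : B * C * D -> R) :
  \sum_q F q = \sum_u \sum_c \sum_d F (u, c, d).
Proof.
rewrite (pair_bigA _ (fun u c => \sum_d F (u, c, d)))/=.
rewrite (pair_bigA _ (fun uc d => F (uc.1, uc.2, d)))/=.
by apply: eq_bigr => [[[u c] d]].
Qed.

Section Multipliers.
Variables (R : realType) (S A : finType) (I : nat).
Variables (pi : S -> S -> R) (beta : R) (s0 : S).
Hypothesis hpi_pos : forall s s', 0 < pi s s'.
Hypothesis beta_gt0 : 0 < beta.
Local Notation J := (J S A I).
Local Notation Q t := (t.-tuple S * t.-tuple A * 'I_I)%type.

(** Enumerates the indices of date [t] whose history starts in [s0]; all others have [pathprob]
    0. *)
Definition hidx t (q : Q t) : J := jmk [tuple of s0 :: q.1.1] q.1.2 q.2.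

(** The mass that [lam] puts on a coordinate of [gvec]; membership in [Lambda] amounts to [0 <= lam]
    and summable weights. *)
Definition weight (lam : J -> R) t (q : Q t) : R :=
  beta ^+ t * (pprob pi s0 q.1.1 * lam (hidx q)).

Lemma weight_ge0 lam t (q : Q t) : (forall j, 0 <= lam j) -> 0 <= weight lam q.
Proof.
by move=> l0; rewrite mulr_ge0 ?exprn_ge0 ?mulr_ge0// ltW// pprob_gt0.
Qed.

Lemma Lambda_term lam t :
  beta ^+ t * (\sum_(st : (t.+1).-tuple S) \sum_(ac : t.-tuple A)
        \sum_i lam (jmk st ac i) * pathprob pi s0 st)
  = \sum_(q : Q t) weight lam q.
Proof.
rewrite sum_triple big_tuple_cons (bigD1 s0)//= [X in _ + X]big1 ?addr0; last first.
  move=> s ss0; do 3!(rewrite big1// => ? _).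
  by rewrite /pathprob theadE (negbTE ss0) mulr0.
rewrite mulr_sumr; apply: eq_bigr => u _; rewrite mulr_sumr.
apply: eq_bigr => ac _; rewrite mulr_sumr; apply: eq_bigr => i _.
by rewrite /pathprob theadE eqxx /weight /= [lam _ * _]mulrC.
Qed.

(** For nonnegative terms, finiteness of the extended real sum is convergence of the real series. *)
Lemma LambdaP lam : Lambda pi beta s0 lam <->
  (forall j, 0 <= lam j) /\ cvgn (series (fun t => \sum_(q : Q t) weight lam q)).
Proof.
have w0 : (forall j, 0 <= lam j) -> forall t, 0 <= \sum_(q : Q t) weight lam q.
  by move=> l0 t; apply: sumr_ge0 => q _; exact: weight_ge0.
rewrite /Lambda /=; under eq_eseriesr do rewrite Lambda_term.
split=> [[l0 ls]|[l0 cw]]; split=> //.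
  exact: nnseries_is_cvg (w0 l0) ls.
apply: (@le_lt_trans _ _ (rseries (fun t => \sum_(q : Q t) weight lam q))%:E);
  last exact: ltry.
apply: lime_le.
  by apply: is_cvg_nneseries => n _ _; rewrite lee_fin w0.
apply: nearW => n; rewrite sumEFin lee_fin.
exact: nondecreasing_cvgn_le (nondecreasing_series (fun n _ _ => w0 l0 n)) cw n.
Qed.

(** * From summable weights to positive functionals *)

Section Pairing.
Variable w : forall t, Q t -> R.
Hypothesis w_ge0 : forall t (q : Q t), 0 <= w q.
Hypothesis w_cvg : cvgn (series (fun t => \sum_(q : Q t) w q)).

Definition pairing (x : J -> R) : R :=
  rseries (fun t => \sum_(q : Q t) w q * x (hidx q)).

Lemma pairing_term_le (M : R) x t : (forall j, `|x j| <= M) ->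
  `|\sum_(q : Q t) w q * x (hidx q)| <= M * \sum_(q : Q t) w q.
Proof.
move=> xM; rewrite (le_trans (ler_norm_sum _ _ _))// mulr_sumr ler_sum// => q _.
by rewrite normrM ger0_norm// mulrC ler_wpM2r.
Qed.

Lemma cvg_pairing x : linfty x ->
  cvgn (series (fun t => \sum_(q : Q t) w q * x (hidx q))).
Proof.
move=> [M xM]; apply: (series_dominated (fun t => pairing_term_le t xM)).
exact: is_cvg_seriesZ.
Qed.

Lemma pairing_pos_cont : pos_cont_functional pairing.
Proof.
split=> [x y lx ly|c x lx||x lx x0].
- rewrite /pairing -rseriesD; [|exact: cvg_pairing|exact: cvg_pairing].
  apply: eq_rseries => t; rewrite -big_split/=.
  by apply: eq_bigr => q _; rewrite mulrDr.
- rewrite /pairing -rseriesZ; last exact: cvg_pairing.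
  apply: eq_rseries => t; rewrite mulr_sumr.
  by apply: eq_bigr => q _; rewrite mulrCA.
(* The continuity constant is the total mass. *)
- exists (rseries (fun t => \sum_(q : Q t) w q)) => x M xM.
  rewrite mulrC -rseriesZ//; apply: ler_norm_rseries => [t|].
    exact: pairing_term_le.
  exact: is_cvg_seriesZ.
- apply: rseries_ge0 (cvg_pairing lx) => t.
  by apply: sumr_ge0 => q _; rewrite mulr_ge0.
Qed.

End Pairing.

(** * From positive functionals to multipliers *)

Section RestrictedFunctional.
Variable phi : (J -> R) -> R.
Hypothesis hphi : pos_cont_functional phi.

Definition fweight t (q : Q t) : R := phi (unit_vec R (hidx q)).

Lemma functional_ge_truncation T x : linfty x ->
  (forall t (st : t.+1.-tuple S) ac i,
     ~~ ((thead st == s0) && (t < T)%N) -> 0 <= x (jmk st ac i)) ->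
  \sum_(t < T) \sum_(q : Q t) fweight q * x (hidx q) <= phi x.
Proof.
move=> lx x0.
(* The double sum becomes a single sum over a finite type of pairs, embedded in [J] by [e]. *)
rewrite (sig_big_dep _ (fun t : 'I_T => predT) (fun t q => fweight q * x (hidx q)))/=.
pose e (k : {t : 'I_T & Q t}) := hidx (tagged k).
have ie : injective e.
  move=> [t [[u ac] i]] [t' [[u' ac'] i']]; rewrite /e /hidx /jmk /= => E.
  have tt' : t = t' by apply: val_inj; exact: (congr1 tag E).
  subst t'; move/eqP: E; rewrite -tag_eqE /tag_eq/= eqxx /= tagged_asE.
  by move=> /eqP[] uu' -> ->; congr existT; congr (_, _, _); apply: val_inj.
rewrite (eq_bigr (fun k => x (e k) * phi (unit_vec R (e k)))) => [|k _]; last by rewrite mulrC.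
apply: functional_ge_partial_sum => // -[t [[st ac] i]] ne.
apply: x0; apply/negP => /andP[/eqP st0 tT].
have /negP[] := ne (@Tagged _ (Ordinal tT) (fun t : 'I_T => Q t)
  ([tuple of behead st], ac, i)).
apply/eqP; rewrite /e /hidx /jmk /=; congr existT; congr (_, _, _).
by rewrite [LHS](tuple_eta st) st0; apply: val_inj.
Qed.

Lemma fweight_ge0 t (q : Q t) : 0 <= fweight q.
Proof. exact: functional_unit_vec_ge0. Qed.

(** The constant family 1 is nonnegative everywhere, so its image under [phi] bounds all partial
    sums. *)
Lemma cvg_fweight : cvgn (series (fun t => \sum_(q : Q t) fweight q)).
Proof.
apply: (series_nneg_bounded (W := phi (fun=> 1)) _ _).1 => [t|T].
  by apply: sumr_ge0 => q _; exact: fweight_ge0.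
have := @functional_ge_truncation T (fun=> 1).
under eq_bigr do under eq_bigr do rewrite mulr1.
by apply; first by exists 1 => j; rewrite normr1.
Qed.

(* Coordinates at histories not starting in s0 get the junk multiplier x/0 = 0. *)
Definition multiplier (j : J) : R :=
  phi (unit_vec R j) / (beta ^+ tag j * pathprob pi s0 (tagged j).1.1).

Lemma weight_multiplier t (q : Q t) : weight multiplier q = fweight q.
Proof.
rewrite /weight /multiplier /= /pathprob theadE eqxx mulrA.
by rewrite mulrC divfK// mulf_neq0// ?expf_neq0 ?gt_eqF// pprob_gt0.
Qed.

Lemma Lambda_multiplier : Lambda pi beta s0 multiplier.
Proof.
apply/LambdaP; split => [j|].
  rewrite divr_ge0 ?functional_unit_vec_ge0// mulr_ge0 ?exprn_ge0 ?(ltW beta_gt0)//.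
  by rewrite /pathprob; case: ifP => // _; rewrite ltW// pprob_gt0.
under eq_fun do under eq_bigr do rewrite weight_multiplier.
exact: cvg_fweight.
Qed.

End RestrictedFunctional.
End Multipliers.

(** * Comparison of the two dual values *)

Section LagrangianPairing.
Variables (R : realType) (S A : finType) (X : countType) (I : nat).
Variable pi : S -> S -> R.
Variables (zeta : X -> A -> S -> X).
Variables (r : X -> A -> S -> R) (g : 'I_I -> X -> A -> S -> R).
Variables (gbar : 'I_I -> R) (beta : R).
Hypothesis hpi_pos : forall s s', 0 < pi s s'.
Hypothesis hpi_sum : forall s, \sum_(s' : S) pi s s' = 1.
Hypothesis hbeta : 0 < beta < 1.
Variables (G M : R) (gamma : 'I_I -> R) (s0 : S).
Hypothesis hG : forall i x a s, `|g i x a s| <= G.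
Hypothesis hM : forall x a s, `|r x a s + \sum_i gamma i * g i x a s| <= M.
Local Notation Q t := (t.-tuple S * t.-tuple A * 'I_I)%type.

(** The indicator in [gvec] collapses the sum over action strings to the one generated by the
    plan. *)
Lemma sum_weight_gvec (lam : J S A I -> R) x a t :
  \sum_(q : Q t) weight pi beta s0 lam q * gvec pi zeta g gbar beta x a (hidx s0 q)
  = beta ^+ t * \sum_(u : t.-tuple S) pprob pi s0 u *
     \sum_i lam (jmk [tuple of s0 :: u] (actions_along a [tuple of s0 :: u]) i)
                 * (condG pi zeta g beta x a i s0 u - gbar i).
Proof.
rewrite sum_triple mulr_sumr; apply: eq_bigr => u _.
rewrite exchange_big/= !mulr_sumr; apply: eq_bigr => i _.
rewrite (bigD1 (actions_along a [tuple of s0 :: u]))//= big1 ?addr0 => [|ac ne].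
  by rewrite eqxx mul1r /weight /hidx /= theadE !mulrA.
by rewrite eq_sym (negbTE ne) mul0r mulr0.
Qed.

(** The series may be split because both parts converge: one is discounted and bounded, the other
    pairs summable weights with a bounded family. *)
Lemma Lag_pairing (lam : J S A I -> R) x a : Lambda pi beta s0 lam ->
  Lag pi zeta r g gbar beta gamma x s0 a lam
  = fobj pi zeta r g beta gamma x s0 a
    + pairing s0 (weight pi beta s0 lam) (gvec pi zeta g gbar beta x a).
Proof.
have /andP[b0 _] := hbeta.
move=> /(LambdaP s0 hpi_pos b0)[l0 cw].
rewrite /pairing -rseriesD; last 2 first.
- exact: (cvg_dsum hpi_pos hpi_sum hbeta (F := fun u => r (xof zeta x a (s0 :: u))
    (a (s0 :: u)) (last s0 u) + \sum_i gamma i * g i (xof zeta x a (s0 :: u))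
    (a (s0 :: u)) (last s0 u))).
- apply: cvg_pairing => //; first by move=> t q; exact: weight_ge0.
  exact: linfty_gvec.
apply: eq_rseries => t; rewrite sum_weight_gvec -mulrDr -big_split/=.
by congr (_ * _); apply: eq_bigr => u _; rewrite -mulrDr.
Qed.

End LagrangianPairing.

(** [L] will be a supremum, possibly [+oo]; [-oo] is excluded by the real lower bounds. *)
Lemma lee_of_cvg (R : realType) (e : nat -> R) (l : R) (L : \bar R) :
  e @ \oo --> l -> (forall n, ((e n)%:E <= L)%E) -> (l%:E <= L)%E.
Proof.
move=> el; case: L => [L||] eL; last by have := eL 0%N; rewrite leeNy_eq.
  by rewrite lee_fin; apply: (cvgr_to_le el); apply: nearW => n; rewrite -lee_fin.
exact: leey.
Qed.

(** * Truncated plans and the lower bound on the values of a functional *)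

Section Splicing.
Variables (R : realType) (S A : finType) (X : countType) (I : nat).
Variable pi : S -> S -> R.
Variables (zeta : X -> A -> S -> X) (p : X -> A -> S -> R).
Variables (r : X -> A -> S -> R) (g : 'I_I -> X -> A -> S -> R).
Variables (gbar : 'I_I -> R) (beta : R).
Hypothesis hpi_pos : forall s s', 0 < pi s s'.
Hypothesis hpi_sum : forall s, \sum_(s' : S) pi s s' = 1.
Hypothesis hbeta : 0 < beta < 1.
Variables (G M : R) (gamma : 'I_I -> R) (x0 : X) (s0 : S).
Hypothesis hG : forall i x a s, `|g i x a s| <= G.
Hypothesis hM : forall x a s, `|r x a s + \sum_i gamma i * g i x a s| <= M.
Variable b : X -> S -> plan S A.
Hypothesis hb : forall x s, feasible pi zeta p g gbar beta x s (b x s).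
Variable phi : (J S A I -> R) -> R.
Hypothesis hphi : pos_cont_functional phi.
Local Notation Q t := (t.-tuple S * t.-tuple A * 'I_I)%type.
Local Notation f := (fobj pi zeta r g beta gamma x0 s0).
Local Notation gv := (gvec pi zeta g gbar beta x0).
Local Notation W t := (\sum_(q : Q t) fweight s0 phi q).

(** [phi] also sees histories starting outside [s0]; switching there at once makes their coordinates
    nonnegative. *)
Definition truncate (T : nat) (a : plan S A) : plan S A :=
  splice zeta (fun s => if s == s0 then T else 0%N) b x0 a.

(** The first error term is the loss in [f], the second the loss in the coordinates before [T],
    weighted by their masses. *)
Lemma truncate_value_ge (a : plan S A) (T : nat) :
  f a + \sum_(t < T) \sum_(q : Q t) fweight s0 phi q * gv a (hidx s0 q)
    - (M + M) / (1 - beta) * beta ^+ T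
    - (G + G) / (1 - beta) * \sum_(t < T) W t * beta ^+ (T - t)
  <= f (truncate T a) + phi (gv (truncate T a)).
Proof.
set c := truncate T a; pose tau s := if s == s0 then T else 0%N.
have fc := fobj_splice_close zeta hpi_pos hpi_sum hbeta tau b x0 a s0 hM.
have {}fc : f a - (M + M) / (1 - beta) * beta ^+ T <= f c.
  rewrite lerBlDr -lerBlDl (le_trans (ler_norm _))//.
  by move: fc; rewrite /tau eqxx.
rewrite -addrA addrACA; apply: lerD => //.
have lc : linfty (gv c) by exact: linfty_gvec.
(* [phi] is bounded below by its masses on dates before [T]; the remaining coordinates lie after a
   switch. *)
apply: (le_trans _ (functional_ge_truncation hphi (T := T) (s0 := s0) lc _)); last first.
  move=> t st ac i; rewrite negb_and -leqNgt => st0.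
  apply: gvec_splice_ge0 => //; rewrite /tau.
  by case: eqP st0 => // _; rewrite orFb.
rewrite lerBlDr -lerBlDl mulr_sumr -sumrB ler_sum// => t _.
rewrite mulr_suml mulr_sumr -sumrB ler_sum// => q _.
rewrite -mulrBr mulrCA ler_wpM2l ?fweight_ge0//.
rewrite (le_trans (ler_norm _))// distrC.
have tT : (t < tau (thead [tuple of s0 :: q.1.1]))%N by rewrite theadE /tau eqxx.
have := gvec_splice_close zeta gbar hpi_pos hpi_sum hbeta hG b x0 a q.1.2 q.2 tT.
by rewrite theadE [tau s0]/tau eqxx.
Qed.

(** Let [T] tend to infinity in [truncate_value_ge]: the left side tends to the Lagrangian, and each
    right side is the value of an admissible plan. *)
Lemma Lag_le_sup (a : plan S A) : Aplans zeta p x0 a ->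
  ((Lag pi zeta r g gbar beta gamma x0 s0 a (multiplier pi beta s0 phi))%:E
   <= ereal_sup [set (f a + phi (gv a))%:E | a in Aplans zeta p x0])%E.
Proof.
move=> ha; have /andP[b0 b1] := hbeta.
have lm := Lambda_multiplier s0 hpi_pos b0 hphi.
rewrite (Lag_pairing zeta gbar hpi_pos hpi_sum hbeta hG hM _ _ lm).
have cW := cvg_fweight (s0 := s0) hphi.
have cvK := cvg_discounted_convolution hbeta
  (fun t => sumr_ge0 _ (fun q _ => fweight_ge0 s0 hphi q)) cW.
have cvb : (fun T => beta ^+ T) @ \oo --> (0 : R).
  by apply: cvg_expr; rewrite ger0_norm ?(ltW b0).
have cvg_sums := cvg_pairing (s0 := s0) (fun t q => fweight_ge0 s0 hphi q) cW
  (linfty_gvec zeta gbar hpi_pos hpi_sum hbeta hG x0 a).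
apply: (lee_of_cvg (e := fun T => f a +
    \sum_(t < T) \sum_(q : Q t) fweight s0 phi q * gv a (hidx s0 q)
    - (M + M) / (1 - beta) * beta ^+ T
    - (G + G) / (1 - beta) * \sum_(t < T) W t * beta ^+ (T - t))).
  (* The limit is written with its two vanishing error terms to match the shape of the sequence. *)
  rewrite (_ : _ + pairing _ _ _ = f a + pairing s0 (fweight s0 phi) (gv a)
      - (M + M) / (1 - beta) * 0 - (G + G) / (1 - beta) * 0); last first.
    rewrite !mulr0 !subr0; congr (_ + _).
    by apply: eq_rseries => t; apply: eq_bigr => q _; rewrite weight_multiplier.
  apply: cvgB; last exact: cvgM (cvg_cst _) cvK.
  apply: cvgB; last exact: cvgM (cvg_cst _) cvb.
  apply: cvgD; first exact: cvg_cst.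
  rewrite (_ : (fun T => _) =
      series (fun t => \sum_(q : Q t) fweight s0 phi q * gv a (hidx s0 q))).
    exact: cvg_sums.
  by apply/funext => T; rewrite /series/= big_mkord.
move=> T; apply: (@le_trans _ _ (f (truncate T a) + phi (gv (truncate T a)))%:E).
  by rewrite lee_fin truncate_value_ge.
by apply: ereal_sup_ubound; exists (truncate T a) => //; exact: Aplans_splice.
Qed.

End Splicing.

Theorem theoremC1 (R : realType) (S : finType) (A : finType) (X : countType)
  (I : nat) (pi : S -> S -> R) (zeta : X -> A -> S -> X) (p : X -> A -> S -> R)
  (r : X -> A -> S -> R) (g : 'I_I -> X -> A -> S -> R) (gbar : 'I_I -> R)
  (beta : R)
  (hpi_pos : forall s s', 0 < pi s s')
  (hpi_sum : forall s, \sum_(s' : S) pi s s' = 1)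
  (hbeta : 0 < beta < 1)
  (hr : exists M : R, forall x a s, `|r x a s| <= M)
  (hg : forall i, exists M : R, forall x a s, `|g i x a s| <= M)
  (hfeas : forall (x0 : X) (s0 : S),
     exists a, feasible pi zeta p g gbar beta x0 s0 a)
  (gamma : 'I_I -> R) (hgamma : forall i, 0 <= gamma i)
  (x0 : X) (s0 : S) :
  let f := fobj pi zeta r g beta gamma x0 s0 in
  let gv := gvec pi zeta g gbar beta x0 in
  ereal_inf [set ereal_sup [set (f a + phi (gv a))%:E | a in Aplans zeta p x0]
            | phi in @ldual_pos R (J S A I)]
  = Dval pi zeta p r g gbar beta gamma x0 s0.
Proof.
move=> f gv.
have [Mr hMr] := hr.
have [Mg hMg] := choice hg.
pose G := \sum_i `|Mg i|.
have hG i x a s : `|g i x a s| <= G.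
  rewrite (le_trans (hMg i x a s))// (le_trans (ler_norm _))//.
  by rewrite /G (bigD1 i)//= lerDl sumr_ge0.
pose M := Mr + \sum_i `|gamma i| * G.
have hM x a s : `|r x a s + \sum_i gamma i * g i x a s| <= M.
  rewrite (le_trans (ler_normD _ _))// lerD//.
  rewrite (le_trans (ler_norm_sum _ _ _))// ler_sum// => i _.
  by rewrite normrM ler_wpM2l.
(* Choice selects one feasible continuation plan for every state. *)
have [b hb] : exists b, forall x s, feasible pi zeta p g gbar beta x s (b x s).
  have [b hb] := choice (fun xs : X * S => hfeas xs.1 xs.2).
  by exists (fun x s => b (x, s)) => x s; exact: hb (x, s).
have /andP[b0 _] := hbeta.
apply/le_anti/andP; split; apply: le_ereal_inf_tmp.
  move=> _ [lam hlam <-].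
  have [l0 cw] := (LambdaP s0 hpi_pos b0 lam).1 hlam.
  (* For [d <= D], the functional induced by [lam] has the same Lagrangian at every plan. *)
  apply: ereal_inf_lbound; exists (pairing s0 (weight pi beta s0 lam)).
    by apply: pairing_pos_cont => // t q; exact: weight_ge0.
  congr ereal_sup; apply: eq_imagel => a _.
  by rewrite (Lag_pairing zeta gbar hpi_pos hpi_sum hbeta hG hM _ _ hlam).
move=> _ [phi hphi <-].
(* For [D <= d], the multiplier extracted from [phi] is compared plan by plan. *)
apply: (@le_trans _ _ (ereal_sup [set
  (Lag pi zeta r g gbar beta gamma x0 s0 a (multiplier pi beta s0 phi))%:E
  | a in Aplans zeta p x0])).
  apply: ereal_inf_lbound; exists (multiplier pi beta s0 phi) => //.
  exact: Lambda_multiplier.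
apply: ge_ereal_sup => _ [a ha <-].
exact: Lag_le_sup hb _ hphi _ ha.
Qed.
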